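(* Let $k\ge1$ and let $f_0,f_1,f_2,\dots$ be holomorphic automorphisms of $\mathbb{C}^k$, all having an attracting fixed point at the origin. Fix a sequence $(r_j)_{j\ge0}$ of positive radii with $r_j\to0$ such that for every $j\ge0$ there are constants $0<\mu_j<1$ and $C_j>0$ with $$\|f_j^n(z)\|\le C_j\mu_j^n\|z\|\qquad\text{for all } z\in B(0,r_j),\ n\ge0.$$ Then for $n_0,n_1,\dots$ sufficiently large (i.e. there are integers $m_0,m_1,\dots$ such that the following holds whenever $n_j\ge m_j$ for all $j\ge 0$) we have $$\mathcal{F}_0=\Omega_{(r_j),(n_j)}.$$
   Context: $B(0,r)$ is the open ball of radius $r$ centered at the origin of $\mathbb{C}^k$, and $f_j^n$ is the $n$-th iterate of $f_j$. The integers $n_j$ are always taken large enough that $f_j^{n_j}(B(0,r_j))\subset B(0,r_{j+1})$ for all $j\ge0$. The calibrated basin is $$\Omega_{(r_j),(n_j)}:=\bigcup_{j\in\mathbb{N}}\big(f_{j-1}^{n_{j-1}}\circ\cdots\circ f_0^{n_0}\big)^{-1}(B(0,r_j)),$$ where for $j=0$ the empty composition is the identity. $\mathcal{F}_0$ denotes the Fatou component containing the origin of the non-autonomous system given by $f_0^{n_0},f_1^{n_1},\dots$, that is, the largest connected open set containing the origin on which the sequence $f_j^{n_j}\circ\cdots\circ f_0^{n_0}$ converges locally uniformly to $0$ as $j\to\infty$. *)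

(* Defs.v *)
(* MathComp-Analysis, with the complex numbers R[i] of mathcomp-real-closed. *)
From HB Require Import structures.
From mathcomp Require Import all_boot all_order all_algebra.
From mathcomp Require Import complex.
From mathcomp Require Import all_classical all_reals all_analysis.

Set Implicit Arguments.
Unset Strict Implicit.
Unset Printing Implicit Defensive.

Import Order.TTheory GRing.Theory Num.Theory.
Import numFieldNormedType.Exports.

Local Open Scope classical_set_scope.
Local Open Scope ring_scope.
Local Open Scope complex_scope.

(* Same pattern as numFieldNormedType: this puts on R[i] the topology of its
   modulus, as a normed module over itself; 'rV[R[i]]_k inherits the product
   topology and `differentiable` on it means C-differentiable. *)
#[non_forgetful_inheritance]
HB.instance Definition _ (R : realType) := NormedModule.copy R[i] R[i]^o.

Notation Cn R k := 'rV[R[i]]_k (only parsing).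

Section Automorphisms.
Context {R : realType} {k : nat}.
Implicit Types f : Cn R k -> Cn R k.

(* `|z| on 'rV[R[i]]_k is the sup norm, hence this separate definition. The
   modulus of a coordinate is R[i]-valued; Re reads it as a real number. *)
Definition euclidean_norm (z : Cn R k) : R :=
  Num.sqrt (\sum_(i < k) complex.Re `|z ord0 i| ^+ 2).

Definition euclidean_ball (r : R) : set (Cn R k) := [set z | euclidean_norm z < r].

Definition holomorphic f := forall z : Cn R k, differentiable f z.

Definition holomorphic_automorphism f :=
  holomorphic f /\
  exists g : Cn R k -> Cn R k, [/\ holomorphic g, cancel f g & cancel g f].

Definition attracting_at0 f :=
  f 0 = 0 /\ forall a : R[i], eigenvalue (jacobian f 0) a -> `|a| < 1.

End Automorphisms.

Section Basins.
Context {R : realType} {k : nat}.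
Implicit Types (f F G : nat -> Cn R k -> Cn R k) (n : nat -> nat)
  (r : nat -> R) (U : set (Cn R k)).

Definition iterates f n : nat -> Cn R k -> Cn R k := fun j => iter (n j) (f j).

(* G_{j-1} \o ... \o G_0; the identity for j = 0. *)
Fixpoint comp_upto G (j : nat) : Cn R k -> Cn R k :=
  if j is i.+1 then G i \o comp_upto G i else id.

Definition calibrated_basin f r n : set (Cn R k) :=
  \bigcup_j (comp_upto (iterates f n) j @^-1` euclidean_ball (r j)).

Definition cvg_locally_uniformly0 U F :=
  forall z, U z -> exists2 V : set (Cn R k), nbhs z V &
    {uniform V, F @ \oo --> (cst 0 : Cn R k -> Cn R k)}.

(* The sequence attached to the system G is G_j \o ... \o G_0, j >= 0. *)
Definition fatou_domain G U :=
  [/\ open U, connected U, U 0 &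
      cvg_locally_uniformly0 U (fun j => comp_upto G j.+1)].

(* The union of all such domains; fatou_component0_largest shows that it is
   the largest of them. *)
Definition fatou_component0 G : set (Cn R k) :=
  \bigcup_(U in fatou_domain G) U.

Lemma fatou_component0_largest G :
  (exists U, fatou_domain G U) ->
  fatou_domain G (fatou_component0 G) /\
  (forall U, fatou_domain G U -> U `<=` fatou_component0 G).
Proof.
move=> [U0 GU0]; split; last by move=> U GU z Uz; exists U.
split.
- by apply: bigcup_open => U [].
- apply: bigcup_connected; last by move=> U [].
  by exists 0 => U [].
- by exists U0 => //; case: GU0.
- by move=> z [U [_ _ _ cvgU] Uz]; exact: cvgU.
Qed.

End Basins.

(* Main.v *)
Require Import Defs.
From HB Require Import structures.
From mathcomp Require Import all_boot all_order all_algebra.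
From mathcomp Require Import complex.
From mathcomp Require Import all_classical all_reals all_analysis.
From mathcomp Require Import ring lra.

Import Order.TTheory GRing.Theory Num.Theory.
Import numFieldNormedType.Exports.

Local Open Scope classical_set_scope.
Local Open Scope ring_scope.
Local Open Scope complex_scope.

(** Write F_j for the iterated maps, G_j = F_(j-1) o ... o F_0, and Omega_j for
    the preimage of B(0, r_j) by G_j, so that the basin Omega is the union of
    the Omega_j.

    The basin is a Fatou domain ([basin_fatou_domain]).  The Omega_j increase;
    on Omega_l the orbit stays in balls whose radii tend to 0, so convergence
    to 0 is locally uniform on Omega.  Each Omega_j is the image of a ball by
    the inverse of G_j, so it is connected, and it contains 0.

    The converse ([fatou_domain_sub_basin]) is where the n_j must be large: a
    point z of a Fatou domain U has an orbit tending to 0, but the radii r_j may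
    tend to 0 much faster than this orbit does.  The n_j are chosen so that F_j
    sends B(0, r_j) not just into B(0, r_(j+1)) but into a ball whose radius is
    super-exponentially small compared with r_(j+1): with B_j = r_j / (2k) and
    N_j such that 1 <= B_j 2^(N_j), this radius is B_(j+1) / (j+2)^(N_(j+1)).
    Since U is connected and meets Omega at 0, it suffices to show that Omega
    is closed in U.  Let z in U be a limit of points of Omega, and join it to
    w in Omega, so close to z that the disc of centre w and radius 2|z - w| in
    the complex line through them lies where the convergence is uniform.  In the
    coordinate x of the point w + x (z - w), every component g of G_j satisfies,
    for j large,
      |g| <= 1 <= B_j 2^(N_j) for |x| = 2,
      |g| <= B_j / (j+1)^(N_j) <= B_j rho^(N_j) for |x| = rho,
    where rho > 0 does not depend on j.  The three circles estimate
    ([hadamard_annulus]), that is, the maximum principle for g / x^(N_j), gives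
    |g(1)| <= B_j, so G_j z belongs to B(0, r_j) and z to Omega.

    The maximum principle has to be proved for functions that are only supposed
    complex differentiable at every point.  Goursat's bisection argument shows
    that a differentiable closed 1-form on a square is exact
    ([closed_form_exact]).  The real part u of a complex differentiable function
    is thus a partial derivative of some function Phi; difference quotients of
    Phi approximate u, have second derivatives, and are harmonic, so the second
    derivative test excludes a strict maximum
    ([cauchy_riemann_no_strict_max]). *)

(** * Calculus of one real variable *)

(** The [eps]-[delta] form makes it possible to compare derivatives over the
    reals and over the complex numbers, whose topologies are distinct
    structures. *)
Lemma is_derive_epsP (K : numFieldType) (f : K -> K) (x0 a : K) :
  is_derive x0 1 f a <->
  forall e : K, 0 < e -> exists2 d : K, 0 < d & forall x, `|x - x0| < d ->
    `|f x - f x0 - a * (x - x0)| <= e * `|x - x0|.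
Proof.
have key : is_derive x0 1 f a <->
    h^-1 * (f (h + x0) - f x0) @[h --> 0^'] --> a.
  have E : (fun h : K => h^-1 *: ((f \o shift x0) (h *: 1) - f x0)) =
           (fun h : K => h^-1 * (f (h + x0) - f x0)).
    by apply/funext => h /=; rewrite [h *: 1]mulr1.
  rewrite -E; split; first by move=> [df <-].
  by move=> hh; apply: DeriveDef; [apply: cvgP hh|apply: cvg_lim hh].
rewrite key; split.
  move=> /cvgrPdist_le H e e0.
  have := H e e0; rewrite /= => -[d /= d0 Hd]; exists d => // x xd.
  have [->|xx0] := eqVneq x x0; first by rewrite !subrr mulr0 subr0 normr0 mulr0.
  have x1 : x - x0 != 0 by rewrite subr_eq0.
  have := Hd (x - x0); rewrite /= sub0r normrN => /(_ xd x1).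
  rewrite subrK => h.
  have -> : f x - f x0 - a * (x - x0) =
     - (a - (x - x0)^-1 * (f x - f x0)) * (x - x0).
    by field.
  by rewrite normrM normrN ler_wpM2r.
move=> H; apply/cvgrPdist_le => e e0.
have [d d0 Hd] := H e e0; exists d => //= h /= ; rewrite sub0r normrN => hd h0.
have := Hd (h + x0); rewrite addrK => /(_ hd).
have -> : f (h + x0) - f x0 - a * h = - (a - h^-1 * (f (h + x0) - f x0)) * h.
  by field.
by rewrite normrM normrN ler_pM2r// normr_gt0.
Qed.

Section OneVariable.
Variable R : realType.
Implicit Types (f : R -> R) (a b : R).

Lemma antiderivative f a b : a < b ->
  (forall x, a <= x <= b -> {for x, continuous f}) ->
  exists F : R -> R, forall x, a < x < b -> is_derive x 1 F (f x).
Proof.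
move=> ab cf.
have fi : lebesgue_measure.-integrable `[a, b] (EFin \o f).
  apply: continuous_compact_integrable; first exact: segment_compact.
  by apply: continuous_in_subspaceT => x; rewrite inE /= in_itv /=; exact: cf.
exists (fun x => (\int[lebesgue_measure]_(t in `[a, x]) f t)%R) => x /andP[ax xb].
have cx : {for x, continuous f} by apply: cf; rewrite !ltW.
have [d1 d2] := continuous_FTC1_closed xb fi ax cx.
rewrite derive1E in d2; exact: DeriveDef d1 d2.
Qed.

Lemma mean_value_inequality f (df : R -> R) (x y M : R) : x <= y ->
  (forall t, x <= t <= y -> is_derive t 1 f (df t)) ->
  (forall t, x <= t <= y -> `|df t| <= M) ->
  `|f y - f x| <= M * (y - x).
Proof.
move=> xy fd dM.
have [t|t txy|c] := @MVT_segment R f df x y xy.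
- by rewrite in_itv /= => /andP[h1 h2]; apply: fd; rewrite !ltW.
- apply: derivable_within_continuous => u; rewrite in_itv /= => /fd h.
  exact: ex_derive.
- rewrite in_itv /= => cxy ->; rewrite normrM [`|y - x|]ger0_norm ?subr_ge0//.
  by rewrite ler_wpM2r ?subr_ge0// dM.
Qed.

(** The derivative vanishes at an interior maximum; a positive second derivative
    makes it positive just to the right, where the function must increase. *)
Lemma second_derivative_pos_not_max f (df : R -> R) (a c d : R) : 0 < d -> 0 < c ->
  (forall x, `|x - a| < d -> is_derive x 1 f (df x)) -> is_derive a 1 df c ->
  ~ (forall x, `|x - a| < d -> f x <= f a).
Proof.
move=> d0 c0 fd /is_derive_epsP dc fm.
have df0 : df a = 0.
  have ab : a - d <= a + d by lra.
  have nb t : t \in `]a - d, a + d[ -> `|t - a| < d.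
    by rewrite in_itv /= ltr_norml => /andP[? ?]; apply/andP; split; lra.
  have aab : a \in `]a - d, a + d[ by rewrite in_itv /=; apply/andP; split; lra.
  have h := @derive1_at_max R f (a - d) (a + d) a ab _ aab _.
  have {}h : is_derive a 1 f 0.
    apply: h => t /nb ht; last exact: fm.
    by have := fd _ ht => -[].
  have aa : `|a - a| < d by rewrite subrr normr0.
  have h2 := fd _ aa.
  by rewrite -(@derive_val _ _ _ _ _ _ _ h2) (@derive_val _ _ _ _ _ _ _ h).
have c20 : 0 < c / 2 by lra.
have [e e0 he] := dc (c / 2) c20.
pose t := Num.min d e / 2.
have t0 : 0 < t by rewrite divr_gt0// lt_min d0.
have m0 : 0 < Num.min d e by rewrite lt_min d0.
have td : t < d.
  have : Num.min d e <= d by rewrite ge_min lexx.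
  rewrite /t; lra.
have te : t < e.
  have : Num.min d e <= e by rewrite ge_min lexx orbT.
  rewrite /t; lra.
have at1 : a < a + t by lra.
have [x|x|x] := @MVT R f df a (a + t) at1.
- rewrite in_itv /= => /andP[? ?]; apply: fd.
  by rewrite ltr_norml; apply/andP; split; lra.
- apply: derivable_within_continuous => u; rewrite in_itv /= => /andP[? ?].
  have : is_derive u 1 f (df u).
    by apply: fd; rewrite ltr_norml; apply/andP; split; lra.
  by case.
- rewrite in_itv /= => /andP[x1 x2].
  have E : a + t - a = t by ring.
  have := fm (a + t); rewrite E gtr0_norm// => /(_ td) h3 fx.
  have xa : 0 < x - a by lra.
  have xe : `|x - a| < e by rewrite gtr0_norm//; lra.
  have := he x xe; rewrite df0 subr0 (gtr0_norm xa) ler_norml => /andP[h1 _].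
  have dfx : 0 < df x * t.
    by rewrite pmulr_lgt0//; have := mulr_gt0 c20 xa; lra.
  lra.
Qed.
End OneVariable.

(** * Additive functions of rectangles *)

Section Rectangles.
Variable R : realType.

Lemma exists_geometric_lt (q c e : R) : 0 <= q < 1 -> 0 < e ->
  exists n : nat, c * q ^+ n < e.
Proof.
move=> /andP[q0 q1] e0.
have h := @cvg_geometric R c q (ltac:(by rewrite ger0_norm)).
have /cvgrPdist_lt/(_ e e0)[n _ hn] := h.
exists n; have := hn n (leqnn n); rewrite /= sub0r normrN.
exact: le_lt_trans (ler_norm _).
Qed.

Lemma nested_intervals (u l : nat -> R) :
  (forall n, u n <= u n.+1) -> (forall n, u n.+1 + l n.+1 <= u n + l n) ->
  (forall n, 0 <= l n) ->
  exists p, forall n, u n <= p <= u n + l n.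
Proof.
move=> uS ulS l0.
have um m n : (m <= n)%N -> u m <= u n.
  by move=> mn; apply: (homo_leq (r := <=%O)) mn => //; exact: le_trans.
have ul m n : (m <= n)%N -> u n + l n <= u m + l m.
  move=> mn; rewrite -[_ <= _]/(u m + l m >= u n + l n).
  apply: (homo_leq (r := fun x y => y <= x) (f := fun n => u n + l n)) mn => //.
  by move=> y x z h1 h2; exact: le_trans h2 h1.
have umn m n : u m <= u n + l n.
  have h1 := um m _ (leq_maxl m n); have h2 := ul n _ (leq_maxr m n).
  have := l0 (maxn m n); lra.
exists (sup (range u)) => n; apply/andP; split.
  by apply: ub_le_sup; [exists (u 0 + l 0) => _ [m _ <-]|exists n].
by apply: ge_sup; [exists (u 0), 0|move=> _ [m _ <-]].
Qed.

Definition rect_additive (W : R -> R -> R -> R -> R) :=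
  forall x0 x1 x2 y0 y1 y2,
    W x0 x2 y0 y2 = W x0 x1 y0 y1 + W x1 x2 y0 y1 + W x0 x1 y1 y2 + W x1 x2 y1 y2.

(** Goursat's bisection.  If W does not vanish on a rectangle, one of its four
    quarters carries at least a quarter of the absolute value, and so on.  The
    nested rectangles shrink to a point p, and at step n the absolute value is
    at least |W| / 4^n, whereas the local hypothesis at p bounds it by a small
    multiple of the squared side lengths, which are also of order 1 / 4^n. *)
Lemma rect_additive_eq0 (W : R -> R -> R -> R -> R) (x0 x1 y0 y1 : R) :
  x0 <= x1 -> y0 <= y1 -> rect_additive W ->
  (forall p q e, x0 <= p <= x1 -> y0 <= q <= y1 -> 0 < e ->
    exists2 d : R, 0 < d & forall a b c f, x0 <= a -> b <= x1 -> y0 <= c -> f <= y1 ->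
      a <= p <= b -> c <= q <= f -> b - a < d -> f - c < d ->
      `|W a b c f| <= e * ((b - a) + (f - c)) ^+ 2) ->
  W x0 x1 y0 y1 = 0.
Proof.
move=> x01 y01 Wadd Wloc; apply/eqP; apply/negPn/negP => W0.
pose L n := (x1 - x0) * 2^-1 ^+ n.
pose M n := (y1 - y0) * 2^-1 ^+ n.
have LS n : L n = L n.+1 + L n.+1.
  by rewrite /L exprSr; field.
have MS n : M n = M n.+1 + M n.+1.
  by rewrite /M exprSr; field.
have q0 n : 0 <= 2^-1 ^+ n :> R by rewrite exprn_ge0.
have L0 n : 0 <= L n by rewrite mulr_ge0// subr_ge0.
have M0 n : 0 <= M n by rewrite mulr_ge0// subr_ge0.
pose bad n (p : R * R) := `|W x0 x1 y0 y1| * 4^-1 ^+ n <=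
  `|W p.1 (p.1 + L n) p.2 (p.2 + M n)|.
have step np : exists p' : R * R, bad np.1 np.2 ->
    [/\ bad np.1.+1 p', np.2.1 <= p'.1 /\ p'.1 + L np.1.+1 <= np.2.1 + L np.1
      & np.2.2 <= p'.2 /\ p'.2 + M np.1.+1 <= np.2.2 + M np.1].
  case: np => n [x y] /=.
  have [bd|nb] := pselect (bad n (x, y)); last by exists (x, y).
  pose h := L n.+1; pose k := M n.+1.
  have hL : L n = h + h by exact: LS. have kM : M n = k + k by exact: MS.
  have h0 : 0 <= h by exact: L0. have k0 : 0 <= k by exact: M0.
  have H : exists2 p' : R * R, bad n.+1 p' &
      [/\ x <= p'.1, p'.1 <= x + h, y <= p'.2 & p'.2 <= y + k].
    apply: contrapT => nex.
    have nb a b : x <= a -> a <= x + h -> y <= b -> b <= y + k ->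
        `|W a (a + h) b (b + k)| < `|W x0 x1 y0 y1| * 4^-1 ^+ n.+1.
      by move=> ? ? ? ?; rewrite ltNge; apply/negP => /= bd'; apply: nex; exists (a, b).
    have := bd; rewrite /bad /= (Wadd x (x + h) _ y (y + k)) hL kM !addrA.
    set w1 := W x (x + h) y _; set w2 := W (x + h) _ y _.
    set w3 := W x (x + h) (y + k) _; set w4 := W (x + h) _ (y + k) _.
    have n1 : `|w1| < `|W x0 x1 y0 y1| * 4^-1 ^+ n.+1 by apply: nb => //; lra.
    have n2 : `|w2| < `|W x0 x1 y0 y1| * 4^-1 ^+ n.+1 by apply: nb => //; lra.
    have n3 : `|w3| < `|W x0 x1 y0 y1| * 4^-1 ^+ n.+1 by apply: nb => //; lra.
    have n4 : `|w4| < `|W x0 x1 y0 y1| * 4^-1 ^+ n.+1 by apply: nb => //; lra.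
    have : `|w1 + w2 + w3 + w4| <= `|w1| + `|w2| + `|w3| + `|w4|.
      have := ler_normD (w1 + w2 + w3) w4; have := ler_normD (w1 + w2) w3.
      have := ler_normD w1 w2; lra.
    have : `|W x0 x1 y0 y1| * 4^-1 ^+ n = 4 * (`|W x0 x1 y0 y1| * 4^-1 ^+ n.+1).
      by rewrite exprSr; field.
    lra.
  by case: H => p' bp' [? ? ? ?]; exists p' => _; rewrite hL kM; split; [|split|split] => //;
     rewrite -/h -/k; lra.
have [s sP] := choice step.
pose u := fix u n : R * R := if n is m.+1 then s (m, u m) else (x0, y0).
have ub n : bad n (u n).
  elim: n => [|n IH]; last by have [] := sP (n, u n) IH.
  by rewrite /bad /= /L /M !expr0 !mulr1 !(addrC _ (_ - _)) !subrK.
have [p pP] : exists p, forall n, (u n).1 <= p <= (u n).1 + L n.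
  by apply: nested_intervals => // n; have [_ [] ] := sP (n, u n) (ub n).
have [q qP] : exists q, forall n, (u n).2 <= q <= (u n).2 + M n.
  by apply: nested_intervals => // n; have [_ _ [] ] := sP (n, u n) (ub n).
have ux n : x0 <= (u n).1 /\ (u n).1 + L n <= x1.
  elim: n => [|n [i1 i2]]; first by rewrite /= /L expr0; lra.
  by have [_ [? ?] _] := sP (n, u n) (ub n); split; rewrite /=; lra.
have uy n : y0 <= (u n).2 /\ (u n).2 + M n <= y1.
  elim: n => [|n [i1 i2]]; first by rewrite /= /M expr0; lra.
  by have [_ _ [? ?]] := sP (n, u n) (ub n); split; rewrite /=; lra.
(* [e] is such that [e * S ^+ 2], the local bound rescaled to the initial
   rectangle, is less than the absolute value of W there. *)
pose S := x1 - x0 + (y1 - y0).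
have S0 : 0 <= S by rewrite /S; lra.
pose e := `|W x0 x1 y0 y1| / (S ^+ 2 + 1).
have S1 : 0 < S ^+ 2 + 1 by have := sqr_ge0 S; lra.
have e0 : 0 < e by rewrite divr_gt0// normr_gt0.
have pp : x0 <= p <= x1 by have := pP 0%N; rewrite /= /L expr0; lra.
have qq : y0 <= q <= y1 by have := qP 0%N; rewrite /= /M expr0; lra.
have [d d0 dP] := Wloc p q e pp qq e0.
have [n nP] := @exists_geometric_lt 2^-1 S d (ltac:(lra)) d0.
have LMS : L n + M n = S * 2^-1 ^+ n by rewrite /L /M /S; ring.
have h2 : `|W (u n).1 ((u n).1 + L n) (u n).2 ((u n).2 + M n)| <= e * (S * 2^-1 ^+ n) ^+ 2.
  rewrite -LMS.
  have [? ?] := ux n; have [? ?] := uy n.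
  have := L0 n; have := M0 n => ? ?.
  have := dP (u n).1 ((u n).1 + L n) (u n).2 ((u n).2 + M n).
  rewrite ![_ + L n - _]addrC ![_ + M n - _]addrC !addKr; apply => //; lra.
have := le_trans (ub n) h2.
have -> : (S * 2^-1 ^+ n) ^+ 2 = S ^+ 2 * 4^-1 ^+ n.
  rewrite exprMn -exprM mulnC exprM; congr (_ * _ ^+ n); by field.
have q4 : 0 < 4^-1 ^+ n :> R by rewrite exprn_gt0// invr_gt0.
rewrite mulrA (ler_pM2r q4).
apply/negP; rewrite -ltNge /e mulrAC ltr_pdivrMr// ltr_pM2l ?normr_gt0//; lra.
Qed.
End Rectangles.
Arguments rect_additive {R}.

(** * Exactness of differentiable closed forms (Goursat) *)

Section ClosedForms.
Variable R : realType.

(** Total differentiability of a function of two real variables, curried so that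
    its partial functions remain functions on the real line. *)
Definition has_gradient (w : R -> R -> R) (x y a b : R) :=
  forall e : R, 0 < e -> exists2 d : R, 0 < d & forall x' y',
    `|x' - x| < d -> `|y' - y| < d ->
    `|w x' y' - w x y - a * (x' - x) - b * (y' - y)| <= e * (`|x' - x| + `|y' - y|).

Lemma has_gradient_derive_x (w : R -> R -> R) (x y a b : R) : has_gradient w x y a b ->
  is_derive x 1 (w^~ y) a.
Proof.
move=> H; apply/is_derive_epsP => e e0; have [d d0 hd] := H e e0.
exists d => // x' xd; have := hd x' y xd.
by rewrite !subrr mulr0 subr0 normr0 addr0; apply.
Qed.

Lemma has_gradient_derive_y (w : R -> R -> R) (x y a b : R) : has_gradient w x y a b ->
  is_derive y 1 (w x) b.
Proof.
move=> H; apply/is_derive_epsP => e e0; have [d d0 hd] := H e e0.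
exists d => // y' yd; have := hd x y' _ yd.
by rewrite !subrr mulr0 subr0 normr0 add0r; apply.
Qed.

Lemma is_derive_continuous (f : R -> R) (x a : R) : is_derive x 1 f a -> {for x, continuous f}.
Proof. by move=> [h _]; apply/differentiable_continuous/derivable1_diffP. Qed.

(** An approximation of f by an affine function integrates to an approximation of
    its primitive by the corresponding quadratic function. *)
Lemma primitive_estimate (F f : R -> R) (x0 x1 p m a e : R) : x0 <= x1 ->
  (forall t, x0 <= t <= x1 -> is_derive t 1 F (f t)) ->
  (forall t, x0 <= t <= x1 -> `|f t - m - a * (t - p)| <= e) ->
  `|F x1 - F x0 - m * (x1 - x0) - a / 2 * ((x1 - p) ^+ 2 - (x0 - p) ^+ 2)|
    <= e * (x1 - x0).
Proof.
move=> x01 Ff fe.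
pose G t := F t - (m * t + a / 2 * (t - p) ^+ 2).
have -> : F x1 - F x0 - m * (x1 - x0) - a / 2 * ((x1 - p) ^+ 2 - (x0 - p) ^+ 2) =
  G x1 - G x0 by rewrite /G; field.
apply: (@mean_value_inequality R G (fun t => f t - m - a * (t - p))) => // t xt.
have h := Ff t xt.
apply: is_derive_eq.
by rewrite /GRing.scale /=; field.
Qed.

(** When A y is a primitive of P (., y) and B x one of Q (x, .), this is the
    integral of P dx + Q dy along the boundary of [x0, x1] x [y0, y1]. *)
Definition circulation (A B : R -> R -> R) (x0 x1 y0 y1 : R) :=
  (A y0 x1 - A y0 x0) + (B x1 y1 - B x1 y0)
  - (A y1 x1 - A y1 x0) - (B x0 y1 - B x0 y0).

Lemma circulation_additive A B : rect_additive (circulation A B).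
Proof. by move=> *; rewrite /circulation; ring. Qed.

(** The hypothesis says that P dx + Q dy is closed at (p, q): the y-derivative of P
    and the x-derivative of Q are the same number [b].  Replacing P and Q by their
    affine approximations at (p, q) gives a circulation equal to 0, and changes
    the integrand by a small multiple of the side lengths. *)
Lemma closed_form_circulation (A B P Q : R -> R -> R) (p q a b c e : R) :
  has_gradient P p q a b -> has_gradient Q p q b c -> 0 < e ->
  exists2 d : R, 0 < d & forall x0 x1 y0 y1,
    x0 <= p <= x1 -> y0 <= q <= y1 -> x1 - x0 < d -> y1 - y0 < d ->
    (forall x y, x0 <= x <= x1 -> y0 <= y <= y1 ->
       is_derive x 1 (A y) (P x y) /\ is_derive y 1 (B x) (Q x y)) ->
    `|circulation A B x0 x1 y0 y1| <= e * (x1 - x0 + (y1 - y0)) ^+ 2.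
Proof.
move=> hP hQ e0; have e20 : 0 < e / 2 by lra.
have [d1 d10 h1] := hP _ e20; have [d2 d20 h2] := hQ _ e20.
exists (Num.min d1 d2); first by rewrite lt_min d10.
move=> x0 x1 y0 y1 xp yq; rewrite !lt_min => /andP[xd1 xd2] /andP[yd1 yd2] dAB.
have [x0p px1] := andP xp; have [y0q qy1] := andP yq.
have x01 := le_trans x0p px1; have y01 := le_trans y0q qy1.
pose S := (x1 - x0) + (y1 - y0).
have near_p t : x0 <= t <= x1 -> `|t - p| <= x1 - x0.
  by move=> /andP[t0 t1]; rewrite ler_norml; clear -x0p px1 t0 t1; apply/andP; split; lra.
have near_q t : y0 <= t <= y1 -> `|t - q| <= y1 - y0.
  by move=> /andP[t0 t1]; rewrite ler_norml; clear -y0q qy1 t0 t1; apply/andP; split; lra.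
have hA y : y0 <= y <= y1 -> `|A y x1 - A y x0 - (P p q + b * (y - q)) * (x1 - x0)
    - a / 2 * ((x1 - p) ^+ 2 - (x0 - p) ^+ 2)| <= e / 2 * S * (x1 - x0).
  move=> yy; apply: (@primitive_estimate _ (P^~ y)) => // [t tx|t tx].
    exact: (dAB t y tx yy).1.
  have -> : P t y - (P p q + b * (y - q)) - a * (t - p) =
    P t y - P p q - a * (t - p) - b * (y - q) by ring.
  have tp := near_p t tx; have yq' := near_q y yy.
  apply: le_trans (h1 t y (le_lt_trans tp xd1) (le_lt_trans yq' yd1)) _.
  by rewrite ler_pM2l// lerD.
have hB x : x0 <= x <= x1 -> `|B x y1 - B x y0 - (Q p q + b * (x - p)) * (y1 - y0)
    - c / 2 * ((y1 - q) ^+ 2 - (y0 - q) ^+ 2)| <= e / 2 * S * (y1 - y0).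
  move=> xx; apply: (@primitive_estimate _ (Q x)) => // [t ty|t ty].
    exact: (dAB x t xx ty).2.
  have -> : Q x t - (Q p q + b * (x - p)) - c * (t - q) =
    Q x t - Q p q - b * (x - p) - c * (t - q) by ring.
  have xp' := near_p x xx; have tq := near_q t ty.
  apply: le_trans (h2 x t (le_lt_trans xp' xd2) (le_lt_trans tq yd2)) _.
  by rewrite ler_pM2l// lerD.
have {hA}[hA0 hA1] : _ /\ _ := conj (hA y0 (ltac:(by rewrite lexx)))
  (hA y1 (ltac:(by rewrite y01 lexx))).
have {hB}[hB0 hB1] : _ /\ _ := conj (hB x0 (ltac:(by rewrite lexx)))
  (hB x1 (ltac:(by rewrite x01 lexx))).
have E : e * S ^+ 2 = 2 * (e / 2 * S * (x1 - x0)) + 2 * (e / 2 * S * (y1 - y0)).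
  by rewrite /S; field.
rewrite -/S E /circulation; clear -hA0 hA1 hB0 hB1.
move: hA0 hA1 hB0 hB1; rewrite !ler_norml => /andP[? ?] /andP[? ?] /andP[? ?] /andP[? ?].
by apply/andP; split; lra.
Qed.

(** Goursat's theorem for the form P dx + Q dy, closed at every point but with
    partial derivatives that need not be continuous.  The circulation vanishes on
    every rectangle, by additivity and the local estimate; so integrating along
    the x-axis and then vertically, or along the y-axis and then horizontally,
    gives the same function.  The first expression shows that its y-derivative is
    Q, the second one that its x-derivative is P. *)
Lemma closed_form_exact (d : R) (P Q : R -> R -> R) : 0 < d ->
  (forall x y, `|x| <= d -> `|y| <= d -> exists a b c,
     has_gradient P x y a b /\ has_gradient Q x y b c) ->
  exists Phi : R -> R -> R, forall x y : R, `|x| < d -> `|y| < d ->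
    is_derive x 1 (Phi^~ y) (P x y) /\ is_derive y 1 (Phi x) (Q x y).
Proof.
move=> d0 PQ.
have dd : - d < d by lra.
have /choice[A AP] (y : R) : exists A : R -> R, `|y| <= d ->
    forall x : R, `|x| < d -> is_derive x 1 A (P x y).
  have [yd|?] := pselect (`|y| <= d); last by exists (fun=> 0).
  have [x|A HA] := @antiderivative R (P^~ y) (- d) d dd.
    rewrite -ler_norml => xd; have [a [b [c [h _]]]] := PQ x y xd yd.
    exact: is_derive_continuous (has_gradient_derive_x _ _ _ _ _ h).
  by exists A => _ x; rewrite ltr_norml; exact: HA.
have /choice[B BP] (x : R) : exists B : R -> R, `|x| <= d ->
    forall y : R, `|y| < d -> is_derive y 1 B (Q x y).
  have [xd|?] := pselect (`|x| <= d); last by exists (fun=> 0).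
  have [y|B HB] := @antiderivative R (Q x) (- d) d dd.
    rewrite -ler_norml => yd; have [a [b [c [_ h]]]] := PQ x y xd yd.
    exact: is_derive_continuous (has_gradient_derive_y _ _ _ _ _ h).
  by exists B => _ y; rewrite ltr_norml; exact: HB.
have between (x0 x x1 : R) : `|x0| < d -> `|x1| < d -> x0 <= x -> x <= x1 -> `|x| < d.
  rewrite !ltr_norml => /andP[l0 _] /andP[_ l1] xx0 xx1.
  by rewrite (lt_le_trans l0 xx0) (le_lt_trans xx1 l1).
have W0_le x0 x1 y0 y1 : `|x0| < d -> `|x1| < d -> `|y0| < d -> `|y1| < d ->
    x0 <= x1 -> y0 <= y1 -> circulation A B x0 x1 y0 y1 = 0.
  move=> x0d x1d y0d y1d x01 y01.
  apply: rect_additive_eq0 => //; first exact: circulation_additive.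
  move=> p q e /andP[x0p px1] /andP[y0q qy1] e0.
  have pd := between _ _ _ x0d x1d x0p px1; have qd := between _ _ _ y0d y1d y0q qy1.
  have [a [b [c [hP hQ]]]] := PQ p q (ltW pd) (ltW qd).
  have [d' d'0 hd] := closed_form_circulation A B _ _ _ _ _ _ _ _ hP hQ e0.
  exists d' => // u0 u1 v0 v1 xu0 u1x yv0 v1y pu qv ud vd.
  apply: hd => // x y /andP[u0x xu1] /andP[v0y yv1].
  have xd := between _ _ _ x0d x1d (le_trans xu0 u0x) (le_trans xu1 u1x).
  have yd := between _ _ _ y0d y1d (le_trans yv0 v0y) (le_trans yv1 v1y).
  by split; [exact: AP (ltW yd) _ xd|exact: BP (ltW xd) _ yd].
have W0 x y : `|x| < d -> `|y| < d -> circulation A B 0 x 0 y = 0.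
  move=> xd yd; have o : `|0 : R| < d by rewrite normr0.
  case/orP: (le_total 0 x) => x0; case/orP: (le_total 0 y) => y0.
  - exact: W0_le.
  - by have := W0_le _ _ _ _ o xd yd o x0 y0; rewrite /circulation; clear; lra.
  - by have := W0_le _ _ _ _ xd o o yd x0 y0; rewrite /circulation; clear; lra.
  - by have := W0_le _ _ _ _ xd o yd o x0 y0; rewrite /circulation; clear; lra.
exists (fun x y => A 0 x + (B x y - B x 0)) => x y xd yd; split; last first.
  have h := BP x (ltW xd) y yd.
  apply: is_derive_eq; rewrite /GRing.scale/=; ring.
have h := AP y (ltW yd) x xd.
apply: (@near_eq_is_derive _ _ _
    (fun x => A y x + (A 0 0 - A y 0 + B 0 y - B 0 0))).
  apply/nbhs_ballP; exists (d - `|x|); first by rewrite /= subr_gt0.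
  move=> t; rewrite /ball /= distrC => tx; have td : `|t| < d.
    have := ler_normD x (t - x); rewrite addrC subrK; clear -tx; lra.
  by have := W0 t y td yd; rewrite /circulation; clear; lra.
by apply: is_derive_eq; ring.
Qed.
End ClosedForms.
Arguments has_gradient {R}.

(** * Harmonic functions have no strict maximum *)

Section StrictMaximum.
Variable R : realType.

Lemma has_gradient_near (w : R -> R -> R) (x y a b : R) : has_gradient w x y a b ->
  forall e : R, 0 < e -> exists2 d : R, 0 < d & forall x' y',
    `|x' - x| < d -> `|y' - y| < d -> `|w x' y' - w x y| <= e.
Proof.
move=> H e e0; have [d d0 hd] := H 1 ltr01.
pose K := `|a| + `|b| + 2; have K0 : 0 < K.
  by rewrite /K; have := normr_ge0 a; have := normr_ge0 b; lra.
exists (Num.min d (e / K / 2)).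
  by rewrite lt_min d0 !divr_gt0.
move=> x' y'; rewrite !lt_min => /andP[xd xe] /andP[yd ye].
have := hd x' y' xd yd; rewrite mul1r => h.
set s := x' - x in xd xe h *; set t := y' - y in yd ye h *.
have -> : w x' y' - w x y = (w x' y' - w x y - a * s - b * t) + a * s + b * t by ring.
apply: le_trans (_ : (`|s| + `|t|) + `|a| * `|s| + `|b| * `|t| <= _).
  rewrite -!normrM; have := ler_normD (w x' y' - w x y - a * s - b * t + a * s) (b * t).
  have := ler_normD (w x' y' - w x y - a * s - b * t) (a * s); lra.
have E : e = K * (e / K / 2) + K * (e / K / 2).
  by field; rewrite gt_eqF.
rewrite {}E; set c := e / K / 2 in xe ye *.
have := normr_ge0 a; have := normr_ge0 b; have := normr_ge0 s; have := normr_ge0 t.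
rewrite /K; nra.
Qed.

Lemma has_gradient_continuous (w : R -> R -> R) (x y a b : R) : has_gradient w x y a b ->
  {for (x, y), continuous (fun p : R * R => w p.1 p.2)}.
Proof.
move=> /has_gradient_near H; apply/cvgrPdist_le => e e0.
have [d d0 hd] := H e e0.
exists (ball x d, ball y d); first by split; exact: nbhsx_ballx.
move=> [x' y'] [/= h1 h2]; rewrite distrC; apply: hd; rewrite distrC.
  exact: h1.
exact: h2.
Qed.

Lemma mean_value_estimate (F f : R -> R) (x x' m e : R) :
  (forall t, `|t - x| <= `|x' - x| -> is_derive t 1 F (f t)) ->
  (forall t, `|t - x| <= `|x' - x| -> `|f t - m| <= e) ->
  `|F x' - F x - m * (x' - x)| <= e * `|x' - x|.
Proof.
move=> Ff fe; have [xx|/ltW xx] := leP x x'.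
  have h0 : 0 <= x' - x by rewrite subr_ge0.
  have hn t : x <= t <= x' -> `|t - x| <= `|x' - x|.
    by move=> /andP[? ?]; rewrite !ger0_norm//; lra.
  have := @primitive_estimate R F f x x' 0 m 0 e xx.
  rewrite !mul0r subr0 (ger0_norm h0); apply => t /hn ht; first exact: Ff.
  by rewrite mul0r subr0 fe.
have h0 : 0 <= x - x' by rewrite subr_ge0.
have hn t : x' <= t <= x -> `|t - x| <= `|x' - x|.
  by move=> /andP[? ?]; rewrite ![`|_ - x|]distrC !ger0_norm//; lra.
have := @primitive_estimate R F f x' x 0 m 0 e xx.
rewrite !mul0r subr0 => h; rewrite -normrN [`|x' - x|]distrC (ger0_norm h0).
have -> : - (F x' - F x - m * (x' - x)) = F x - F x' - m * (x - x') by ring.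
apply: h => t /hn ht; first exact: Ff.
by rewrite mul0r subr0 fe.
Qed.

(** Continuous partial derivatives give total differentiability; this is used to
    know that a potential is jointly continuous. *)
Lemma potential_has_gradient (F P Q : R -> R -> R) (x y d a b a' b' : R) : 0 < d ->
  (forall x' y', `|x' - x| < d -> `|y' - y| < d ->
    is_derive x' 1 (F^~ y') (P x' y') /\ is_derive y' 1 (F x') (Q x' y')) ->
  has_gradient P x y a b -> has_gradient Q x y a' b' ->
  has_gradient F x y (P x y) (Q x y).
Proof.
move=> d0 hF /has_gradient_near hP /has_gradient_near hQ e e0.
have [d1 d10 h1] := hP e e0; have [d2 d20 h2] := hQ e e0.
exists (Num.min d (Num.min d1 d2)); first by rewrite !lt_min d0 d10.
move=> x' y'; rewrite !lt_min => /and3P[xd xd1 xd2] /and3P[yd yd1 yd2].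
have -> : F x' y' - F x y - P x y * (x' - x) - Q x y * (y' - y) =
  (F x' y' - F x y' - P x y * (x' - x)) + (F x y' - F x y - Q x y * (y' - y)) by ring.
rewrite [e * (_ + _)]mulrDr; apply: le_trans (ler_normD _ _) _; apply: lerD.
  apply: (@mean_value_estimate (F^~ y') (P^~ y')) => t tx.
    by apply: (hF _ _ _ _).1 => //; exact: le_lt_trans xd.
  by apply: h1 => //; exact: le_lt_trans xd1.
apply: (@mean_value_estimate (F x) (Q x)) => t ty.
  by apply: (hF _ _ _ _).2; [rewrite subrr normr0|exact: le_lt_trans yd].
by apply: h2; [rewrite subrr normr0|exact: le_lt_trans yd2].
Qed.

Lemma is_derive_translate (f : R -> R) (x s a : R) :
  is_derive (x + s) 1 f a -> is_derive x 1 (fun t => f (t + s)) a.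
Proof.
move=> /is_derive_epsP H; apply/is_derive_epsP => e e0.
have [d d0 hd] := H e e0; exists d => // t td.
have E : t + s - (x + s) = t - x by ring.
by have := hd (t + s); rewrite E; apply.
Qed.

(** By the Cauchy-Riemann equations u dx - v dy is closed, so it has a potential
    F.  The horizontal difference quotient of F with step s is twice
    differentiable in each variable, with opposite second derivatives, because
    the derivatives of F are u and - v, themselves differentiable.  It is also
    a value of u at a point at distance less than s.  Therefore if u had a strict
    quadratic maximum at 0, then for s small the quotient plus
    c (x^2 + y^2), with c small, would have an interior maximum on a square.
    But its second derivatives have sum 4 c > 0. *)
Lemma cauchy_riemann_no_strict_max (d e : R) (u v : R -> R -> R) : 0 < d -> 0 < e ->
  (forall x y, `|x| <= d -> `|y| <= d -> exists a b,
     has_gradient u x y a b /\ has_gradient v x y (- b) a) ->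
  ~ (forall x y, `|x| <= d -> `|y| <= d -> u x y <= u 0 0 - e * (x ^+ 2 + y ^+ 2)).
Proof.
move=> d0 e0 CR umax.
pose w x y := - v x y.
have wg x y a b : has_gradient v x y (- b) a -> has_gradient w x y b (- a).
  move=> h t t0; have [d' d'0 hd] := h t t0; exists d' => // x' y' xd yd.
  have := hd x' y' xd yd; rewrite -normrN; congr (`|_| <= _); rewrite /w; ring.
have [|F HF] := @closed_form_exact R d u w d0.
  move=> x y xd yd; have [a [b [h1 h2]]] := CR x y xd yd.
  by exists a, b, (- a); split=> //; exact: wg.
pose h := d / 2; have h0 : 0 < h by rewrite /h; lra.
have dh : d = h + h by rewrite /h; field.
have z0 : `|0 : R| <= d by rewrite normr0 ltW.
have [a00 [b00 [g00 _]]] := CR 0 0 z0 z0.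
have eh : 0 < e * h ^+ 2 / 16 by rewrite divr_gt0// mulr_gt0// exprn_gt0.
have [d1 d10 hd1] := has_gradient_near _ _ _ _ _ g00 _ eh.
pose s := Num.min (h / 2) (d1 / 2).
have s0 : 0 < s by rewrite lt_min; apply/andP; split; lra.
have sh : s <= h / 2 by rewrite ge_min lexx.
have sd1 : s <= d1 / 2 by rewrite ge_min lexx orbT.
pose c := e / 16.
pose N x y := s^-1 * (F (x + s) y - F x y) + c * (x ^+ 2 + y ^+ 2).
have hh x : `|x| <= h -> `|x| < d /\ `|x + s| < d.
  by rewrite ler_norml !ltr_norml => /andP[? ?]; split; apply/andP; split; lra.
have Nmv x y : `|x| <= h -> `|y| <= h -> exists t : R, 0 < t < s /\
    N x y = u (x + t) y + c * (x ^+ 2 + y ^+ 2).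
  move=> xh yh; have [xd xsd] := hh _ xh; have [yd _] := hh _ yh.
  have xx : x < x + s by lra.
  have tF t : x <= t <= x + s -> is_derive t 1 (F^~ y) (u t y).
    move=> /andP[? ?]; apply: (HF _ _ _ yd).1; move: xd xsd.
    by rewrite !ltr_norml => /andP[? ?] /andP[? ?]; apply/andP; split; lra.
  have [t|t|t] := @MVT R (F^~ y) (u^~ y) x (x + s) xx.
  - by rewrite in_itv /= => /andP[? ?]; apply: tF; apply/andP; split; lra.
  - apply: derivable_within_continuous => t'; rewrite in_itv /= => /tF ht.
    exact: ex_derive.
  rewrite in_itv /= => /andP[? ?] E; exists (t - x); split; first by apply/andP; split; lra.
  by rewrite /N E [x + (t - x)]addrC subrK; field; rewrite gt_eqF.
(* [e * h ^+ 2 / 16] leaves room in the comparison of the boundary with the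
   centre: at a boundary point the quotient, a value of u at distance at
   least [h / 2] of 0, is below [u 0 0] by at least [e * h ^+ 2 / 4], and
   the term in [c] adds at most [e * h ^+ 2 / 8]. *)
have Ncenter : u 0 0 - e * h ^+ 2 / 16 <= N 0 0.
  have z1 : `|0 : R| <= h by rewrite normr0 ltW.
  have [t [/andP[? ?] ->]] := Nmv 0 0 z1 z1.
  rewrite add0r expr0n /= addr0 mulr0 addr0.
  have := hd1 t 0; rewrite !subr0 normr0 (@gtr0_norm _ t)// => /(_ _ d10).
  have td1 : t < d1 by lra.
  by move=> /(_ td1); rewrite ler_norml => /andP[? _]; lra.
have Nbd x y : `|x| <= h -> `|y| <= h -> h <= `|x| \/ h <= `|y| -> N x y < N 0 0.
  move=> xh yh bd; apply: lt_le_trans Ncenter.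
  have [t [/andP[? ?] ->]] := Nmv x y xh yh.
  have [/ltW xd xsd] := hh _ xh; have [/ltW yd _] := hh _ yh.
  have := umax (x + t) y _ yd.
  have xtd : `|x + t| <= d.
    move: xh; rewrite !ler_norml => /andP[? ?]; apply/andP.
    by split; lra.
  move=> /(_ xtd).
  have low : (h / 2) ^+ 2 <= (x + t) ^+ 2 + y ^+ 2.
    case: bd => [hx|hy].
      have : h / 2 <= `|x + t|.
        have := ler_normD (x + t) (- t); rewrite addrK normrN (@gtr0_norm _ t)//; lra.
      have h20 : 0 <= h / 2 by lra.
      rewrite -(ler_pXn2r (n := 2))// ?nnegrE// real_normK ?num_real//.
      have := sqr_ge0 y; lra.
    have : h / 2 <= `|y| by lra.
    have h20 : 0 <= h / 2 by lra.
    rewrite -(ler_pXn2r (n := 2))// ?nnegrE// real_normK ?num_real//.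
    have := sqr_ge0 (x + t); lra.
  have sq z : `|z| <= h -> z ^+ 2 <= h ^+ 2.
    by move=> zh; rewrite -[z ^+ 2]real_normK ?num_real// ler_pXn2r ?nnegrE// ltW.
  have := sq _ xh; have := sq _ yh.
  move=> q1 q2 q3.
  have : e * (h / 2) ^+ 2 <= e * ((x + t) ^+ 2 + y ^+ 2) by rewrite ler_pM2l.
  have : c * (x ^+ 2 + y ^+ 2) <= c * (h ^+ 2 + h ^+ 2).
    by rewrite ler_pM2l ?lerD// /c divr_gt0.
  have -> : e * (h / 2) ^+ 2 = e * h ^+ 2 / 4 by field.
  rewrite /c; lra.
have sF x y : `|x| < d -> `|y| < d -> exists a b, has_gradient F x y a b.
  move=> xd yd; have [a [b [g1 /wg g2]]] := CR _ _ (ltW xd) (ltW yd).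
  exists (u x y), (w x y).
  apply: (@potential_has_gradient F u w x y (Num.min (d - `|x|) (d - `|y|)) _ _ _ _ _ _ g1 g2).
    by rewrite lt_min !subr_gt0 xd.
  move=> x' y'; rewrite !lt_min => /andP[? _] /andP[_ ?].
  have := ler_normD x (x' - x); have := ler_normD y (y' - y).
  rewrite ![_ + (_ - _)]addrC !subrK => ? ?; apply: HF; lra.
have [] := @compact_EVT_max (R * R)%type R (fun p => N p.1 p.2) (`[- h, h] `*` `[- h, h]).
- by exists (0, 0); split => /=; rewrite in_itv /=; apply/andP; split; lra.
- by apply: compact_setX; exact: segment_compact.
- apply: continuous_in_subspaceT => -[x y]; rewrite inE /= !in_itv /= -!ler_norml => -[xh yh].
  have [xd xsd] := hh _ xh; have [yd _] := hh _ yh.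
  have [a [b /has_gradient_continuous g]] := sF _ _ xd yd.
  have [a' [b' /has_gradient_continuous g']] := sF _ _ xsd yd.
  have kx : (fun p : R * R => p.1) p @[p --> (x, y)] --> x by exact: cvg_fst.
  have ky : (fun p : R * R => p.2) p @[p --> (x, y)] --> y by exact: cvg_snd.
  have k1 : {for (x, y), continuous (fun p : R * R => F (p.1 + s) p.2)}.
    apply: (@continuous_comp _ _ _ (fun p : R * R => (p.1 + s, p.2)) (fun p => F p.1 p.2)) => //.
    exact: (cvg_pair (cvgD kx (cvg_cst s)) ky).
  apply: cvgD.
    apply: (@cvgM _ _ (nbhs (x, y)) _ (cst s^-1) (fun p => F (p.1 + s) p.2 - F p.1 p.2)).
      exact: cvg_cst.
    exact: (cvgB k1 g).
  apply: (@cvgM _ _ (nbhs (x, y)) _ (cst c) (fun p => p.1 ^+ 2 + p.2 ^+ 2)).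
    exact: cvg_cst.
  exact: (cvgD (cvgM kx kx) (cvgM ky ky)).
move=> [p q]; rewrite inE /= !in_itv /= -!ler_norml => -[ph qh] pqmax.
have pqmax' x y : `|x| <= h -> `|y| <= h -> N x y <= N p q.
  by move=> xh yh; apply: (pqmax (x, y)); rewrite inE /= !in_itv /= -!ler_norml.
have ph' : `|p| < h.
  rewrite ltNge; apply/negP => hp; have := Nbd p q ph qh (or_introl hp).
  by rewrite ltNge pqmax'// normr0 ltW.
have qh' : `|q| < h.
  rewrite ltNge; apply/negP => hp; have := Nbd p q ph qh (or_intror hp).
  by rewrite ltNge pqmax'// normr0 ltW.
have [pd psd] := hh _ ph; have [qd _] := hh _ qh.
have [a0 [b0 [gu0 gv0]]] := CR _ _ (ltW pd) (ltW qd).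
have [a1 [b1 [gu1 gv1]]] := CR _ _ (ltW psd) (ltW qd).
(* The second derivatives of N at the maximum are [D + 2 * c] and
   [- D + 2 * c]: at least one of them is positive. *)
pose D := s^-1 * (a1 - a0).
have c0 : 0 < c by rewrite /c divr_gt0.
have [D0|D0] := leP 0 D.
  apply: (@second_derivative_pos_not_max R (N^~ q)
    (fun x => s^-1 * (u (x + s) q - u x q) + 2 * c * x) p (D + 2 * c) (h - `|p|)).
  - by rewrite subr_gt0.
  - lra.
  - move=> x xp; have xh : `|x| <= h.
      by have := ler_normD p (x - p); rewrite [_ + (_ - _)]addrC subrK; lra.
    have [xd xsd] := hh _ xh.
    have k1 := (HF _ _ xd qd).1.
    have k2 := is_derive_translate _ _ _ _ (HF _ _ xsd qd).1.
    by apply: is_derive_eq; rewrite /GRing.scale /=; ring.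
  - have k1 := has_gradient_derive_x _ _ _ _ _ _ gu0.
    have k2 := is_derive_translate _ _ _ _ (has_gradient_derive_x _ _ _ _ _ _ gu1).
    by apply: is_derive_eq; rewrite /GRing.scale /= /D; ring.
  - move=> x xp; apply: pqmax' => //.
    by have := ler_normD p (x - p); rewrite [_ + (_ - _)]addrC subrK; lra.
apply: (@second_derivative_pos_not_max R (N p)
  (fun y => s^-1 * (w (p + s) y - w p y) + 2 * c * y) q (- D + 2 * c) (h - `|q|)).
- by rewrite subr_gt0.
- lra.
- move=> y yq; have yh : `|y| <= h.
    by have := ler_normD q (y - q); rewrite [_ + (_ - _)]addrC subrK; lra.
  have [yd _] := hh _ yh.
  have k1 := (HF _ _ pd yd).2; have k2 := (HF _ _ psd yd).2.
  by apply: is_derive_eq; rewrite /GRing.scale /=; ring.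
- have k1 := has_gradient_derive_y _ _ _ _ _ _ gv0.
  have k2 := has_gradient_derive_y _ _ _ _ _ _ gv1.
  by rewrite /w; apply: is_derive_eq; rewrite /GRing.scale /= /D; ring.
- move=> y yq; apply: pqmax' => //.
  by have := ler_normD q (y - q); rewrite [_ + (_ - _)]addrC subrK; lra.
Qed.
End StrictMaximum.

(** * The maximum principle and the three circles estimate *)

Section DerivableField.
Variable K : numFieldType.
Implicit Types (f : K -> K) (c z : K).

Lemma derivable_div_exp f n z : z != 0 -> derivable f z 1 ->
  derivable (fun x => f x * (x ^+ n)^-1) z 1.
Proof.
move=> z0 df; have dX : derivable (fun x : K => x ^+ n) z 1.
  have -> : (fun x : K => x ^+ n) = (id : K -> K) ^+ n.
    by apply/funext => x; rewrite exprfctE.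
  by apply: derivableX; exact: derivable_id.
by apply: (derivableM df); apply: derivableV dX; rewrite expf_neq0.
Qed.

Lemma derivable_scale_addlin f a c z : derivable f z 1 ->
  derivable (fun x => a * f x + c * x) z 1.
Proof.
move=> df; apply: (@derivableD _ _ _ (fun x => a * f x) (fun x => c * x)).
  exact: (derivableM (derivable_cst a _ _) df).
exact: (derivableM (derivable_cst c _ _) (@derivable_id _ _ z 1)).
Qed.
End DerivableField.

Section ComplexVariable.
Variable R : realType.
Implicit Types (z : R[i]) (f g : R[i] -> R[i]).
Local Notation normc := (@Normc.normc R).

Lemma normcRE z : `|z| = (normc z)%:C.
Proof. by []. Qed.

Lemma normc_ge0 z : 0 <= normc z.
Proof. by case: z => a b; exact: sqrtr_ge0. Qed.

Lemma normc_sqr z : normc z ^+ 2 = complex.Re z ^+ 2 + complex.Im z ^+ 2.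
Proof. by case: z => a b; rewrite /= sqr_sqrtr// addr_ge0 ?sqr_ge0. Qed.

Lemma normc_le_ReIm z : normc z <= `|complex.Re z| + `|complex.Im z|.
Proof.
rewrite -(ler_pXn2r (n := 2))// ?nnegrE ?normc_ge0 ?addr_ge0// normc_sqr.
rewrite sqrrD !real_normK ?num_real//.
have := mulr_ge0 (normr_ge0 (complex.Re z)) (normr_ge0 (complex.Im z)); lra.
Qed.

Lemma Re_le_normc z : `|complex.Re z| <= normc z.
Proof.
rewrite -(ler_pXn2r (n := 2))// ?nnegrE ?normc_ge0// normc_sqr real_normK ?num_real//.
by rewrite lerDl sqr_ge0.
Qed.

Lemma Im_le_normc z : `|complex.Im z| <= normc z.
Proof.
rewrite -(ler_pXn2r (n := 2))// ?nnegrE ?normc_ge0// normc_sqr real_normK ?num_real//.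
by rewrite lerDr sqr_ge0.
Qed.

Lemma gt0_complex (z : R[i]) : 0 < z -> exists2 d : R, 0 < d & z = d%:C.
Proof.
by case: z => a b; rewrite ltcE /= => /andP[/eqP -> a0]; exists a.
Qed.

(** The Cauchy-Riemann equations. *)
Lemma complex_derivative_gradient f (x y : R) (c : R[i]) : is_derive (x +i* y) 1 f c ->
  has_gradient (fun s t => complex.Re (f (s +i* t))) x y (complex.Re c) (- complex.Im c) /\
  has_gradient (fun s t => complex.Im (f (s +i* t))) x y (complex.Im c) (complex.Re c).
Proof.
move=> /is_derive_epsP H.
have key (e : R) : 0 < e -> exists2 d : R, 0 < d & forall s t : R,
    `|s - x| < d -> `|t - y| < d ->
    normc (f (s +i* t) - f (x +i* y) - c * ((s - x) +i* (t - y)))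
      <= e * (`|s - x| + `|t - y|).
  move=> e0; have [|d /gt0_complex[d' d'0 ->] hd] := H e%:C; first by rewrite ltcR.
  exists (d' / 2); first by lra.
  move=> s t sx ty; have := hd (s +i* t).
  have -> : (s +i* t) - (x +i* y) = (s - x) +i* (t - y) :> R[i] by [].
  rewrite !normcRE ltcR -rmorphM lecR.
  have h := normc_le_ReIm ((s - x) +i* (t - y)); rewrite /= in h.
  have h2 : normc ((s - x) +i* (t - y)) < d' by rewrite /=; lra.
  move=> /(_ h2) h3; apply: le_trans h3 _.
  by rewrite ler_pM2l.
case: c key {H} => a b key; split => e e0; have [d d0 hd] := key e e0; exists d => // s t sx ty;
  apply: le_trans (hd s t sx ty).
  apply: le_trans (Re_le_normc _); rewrite le_eqVlt; apply/orP; left; apply/eqP; congr `|_|.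
  by case: (f (s +i* t)) => ? ?; case: (f (x +i* y)) => ? ? /=; ring.
apply: le_trans (Im_le_normc _); rewrite le_eqVlt; apply/orP; left; apply/eqP; congr `|_|.
by case: (f (s +i* t)) => ? ?; case: (f (x +i* y)) => ? ? /=; ring.
Qed.

(** The real statement on the square of half-side d / 2, which lies in the disc of
    radius d. *)
Lemma complex_no_strict_max f (z0 : R[i]) (d e : R) : 0 < d -> 0 < e ->
  (forall z, normc (z - z0) <= d -> derivable f z 1) ->
  ~ (forall z, normc (z - z0) <= d ->
       complex.Re (f z) <= complex.Re (f z0) - e * normc (z - z0) ^+ 2).
Proof.
case: z0 => x0 y0 d0 e0 fd fmax.
have hd x y : `|x| <= d / 2 -> `|y| <= d / 2 -> 
    normc (((x + x0) +i* (y + y0)) - (x0 +i* y0)) <= d.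
  move=> xd yd; apply: le_trans (normc_le_ReIm _) _ => /=.
  rewrite !addrK; lra.
have d20 : 0 < d / 2 by lra.
apply: (@cauchy_riemann_no_strict_max R (d / 2) e
  (fun x y => complex.Re (f ((x + x0) +i* (y + y0))))
  (fun x y => complex.Im (f ((x + x0) +i* (y + y0)))) d20 e0).
  move=> x y xd yd; have := derivableP (fd _ (hd x y xd yd)).
  set c := 'D_1 f _ => /complex_derivative_gradient[h1 h2].
  have tr (w : R -> R -> R) a b : has_gradient w (x + x0) (y + y0) a b ->
      has_gradient (fun s t => w (s + x0) (t + y0)) x y a b.
    move=> h t t0; have [d' d'0 hd'] := h t t0; exists d' => // s' t' sd td.
    have := hd' (s' + x0) (t' + y0).
    have -> : s' + x0 - (x + x0) = s' - x by ring.
    have -> : t' + y0 - (y + y0) = t' - y by ring.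
    by apply.
  exists (complex.Re c), (- complex.Im c); rewrite opprK; split.
    exact: (tr (fun s t => complex.Re (f (s +i* t)))).
  exact: (tr (fun s t => complex.Im (f (s +i* t)))).
move=> x y xd yd; have := fmax _ (hd x y xd yd).
by rewrite normc_sqr /= !addrK !add0r.
Qed.

Lemma normc_sqrD z w : normc w ^+ 2 =
  normc z ^+ 2 + complex.Re (2 * z^* * (w - z)) + normc (w - z) ^+ 2.
Proof. by rewrite !normc_sqr; case: z => a b; case: w => c d /=; ring. Qed.

(** Hadamard's three circles theorem in the form of a maximum principle for
    h = g / z^N: if |h| <= B on the two boundary circles, then also between
    them.  Otherwise Re (al h), with al unimodular, exceeds B at z1, and even
    B + e r^2 for e small; then the maximum of Re (al h) + e |z|^2 over the
    closed annulus is at an interior point z0.  Expanding |z|^2 around z0,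
    this says that the complex differentiable function
    al h + 2 e conj(z0) z has a real part with a strict maximum at z0. *)
Lemma hadamard_annulus g (N : nat) (rho r B : R) : 0 < rho -> rho <= r ->
  (forall z, rho <= normc z <= r -> derivable g z 1) ->
  (forall z, normc z = rho \/ normc z = r -> normc (g z) <= B * normc z ^+ N) ->
  forall z, rho <= normc z <= r -> normc (g z) <= B * normc z ^+ N.
Proof.
move=> rho0 rhor gd gbd z1 z1A; rewrite leNgt; apply/negP => gz1.
pose h z := g z * (z ^+ N)^-1.
have normX n z : normc (z ^+ n) = normc z ^+ n.
  by elim: n => [|n IH]; rewrite ?expr0 ?Normc.normc1// !exprS Normc.normcM IH.
have nz z : rho <= normc z -> normc z ^+ N != 0 /\ z != 0.
  move=> zr; have z0 : 0 < normc z by apply: lt_le_trans zr.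
  split; first by rewrite gt_eqF// exprn_gt0.
  by apply/eqP => zz; rewrite zz Normc.normc0 ltxx in z0.
have normh z : rho <= normc z -> normc (h z) = normc (g z) / normc z ^+ N.
  by move=> zr; rewrite /h Normc.normcM Normc.normcV normX.
have hz1 : B < normc (h z1).
  have /andP[z1r _] := z1A; have [/eqP ? _] := nz _ z1r.
  rewrite normh// ltr_pdivlMr// exprn_gt0//; exact: lt_le_trans z1r.
have hd z : rho <= normc z <= r -> derivable h z 1.
  move=> zA; have /andP[zr _] := zA; have [_ z0] := nz _ zr.
  exact: (@derivable_div_exp R[i] g N z z0 (gd z zA)).
have rhoA : rho <= normc (rho%:C) <= r.
  by rewrite /= expr0n addr0 sqrtr_sqr gtr0_norm// lexx.
have B0 : 0 <= B.
  have := gbd rho%:C; rewrite /= expr0n addr0 sqrtr_sqr gtr0_norm// => /(_ (or_introl erefl)).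
  by move=> /(le_trans (normc_ge0 _)); rewrite pmulr_lge0// exprn_gt0.
have hz10 : 0 < normc (h z1) by exact: le_lt_trans hz1.
(* [al] rotates [h z1] onto the positive real axis. *)
pose al := (h z1)^* / (normc (h z1))%:C.
have normal : normc al = 1.
  rewrite /al Normc.normcM Normc.normcV.
  have -> : normc (h z1)^* = normc (h z1) by case: (h z1) => a b /=; rewrite sqrrN.
  have -> : normc (normc (h z1))%:C = normc (h z1).
    by rewrite /= expr0n addr0 sqrtr_sqr gtr0_norm.
  by rewrite divff// gt_eqF.
have Real : complex.Re (al * h z1) = normc (h z1).
  rewrite /al mulrAC [_^* * _]mulrC -sqr_normc normcRE.
  by rewrite -rmorphXn -fmorphV -rmorphM /= expr2 mulfK// gt_eqF.
have r0 : 0 < r by exact: lt_le_trans rhor.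
pose e := (normc (h z1) - B) / (2 * r ^+ 2).
have e0 : 0 < e by rewrite divr_gt0 ?subr_gt0// mulr_gt0// exprn_gt0.
have er : B + e * r ^+ 2 < normc (h z1).
  have -> : e * r ^+ 2 = (normc (h z1) - B) / 2 by rewrite /e; field; rewrite gt_eqF.
  lra.
pose f z := al * h z.
have fd z : rho <= normc z <= r -> derivable f z 1.
  have -> : f = (fun x => al * h x + 0 * x) by apply/funext => x; rewrite mul0r addr0.
  by move=> /hd hz; exact: (@derivable_scale_addlin R[i] h al 0 z hz).
pose phi (p : R * R) := complex.Re (f (p.1 +i* p.2)) + e * (p.1 ^+ 2 + p.2 ^+ 2).
pose A := [set p : R * R | rho ^+ 2 <= p.1 ^+ 2 + p.2 ^+ 2 <= r ^+ 2].
have AE (x y : R) : A (x, y) <-> rho <= normc (x +i* y) <= r.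
  have -> : A (x, y) = (rho ^+ 2 <= normc (x +i* y) ^+ 2 <= r ^+ 2 : Prop).
    by rewrite normc_sqr.
  by rewrite !ler_pXn2r ?nnegrE ?normc_ge0 ?(ltW rho0) ?(ltW r0).
have cA : compact A.
  apply: (@subclosed_compact _ A (`[- r, r] `*` `[- r, r])).
  - have cn : continuous (fun p : R * R => p.1 ^+ 2 + p.2 ^+ 2).
      move=> p; have kx : (fun p : R * R => p.1) q @[q --> p] --> p.1 by exact: cvg_fst.
      have ky : (fun p : R * R => p.2) q @[q --> p] --> p.2 by exact: cvg_snd.
      exact: (cvgD (cvgM kx kx) (cvgM ky ky)).
    have -> : A = (fun p : R * R => p.1 ^+ 2 + p.2 ^+ 2) @^-1` `[rho ^+ 2, r ^+ 2].
      by apply/seteqP; split => p; rewrite /A /= in_itv.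
    by apply: (continuous_closedP _).1 => //; exact: itv_closed.
  - by apply: compact_setX; exact: segment_compact.
  - move=> [x y] /AE /andP[_ h1]; split; rewrite /= in_itv /= -ler_norml; apply: le_trans h1.
      exact: (Re_le_normc (x +i* y)).
    exact: (Im_le_normc (x +i* y)).
have [] := @compact_EVT_max (R * R)%type R phi A _ cA.
- by exists (rho, 0); apply/AE.
- apply: continuous_in_subspaceT => -[x y]; rewrite inE => /AE xyA.
  have [g1 _] := complex_derivative_gradient _ _ _ _ (derivableP (fd _ xyA)).
  have kx : (fun p : R * R => p.1) p @[p --> (x, y)] --> x by exact: cvg_fst.
  have ky : (fun p : R * R => p.2) p @[p --> (x, y)] --> y by exact: cvg_snd.
  apply: cvgD; first exact: (has_gradient_continuous _ _ _ _ _ _ g1).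
  apply: (@cvgM _ _ (nbhs (x, y)) _ (cst e) (fun p => p.1 ^+ 2 + p.2 ^+ 2)).
    exact: cvg_cst.
  exact: (cvgD (cvgM kx kx) (cvgM ky ky)).
move=> [x0 y0]; rewrite inE => /AE; set z0 := x0 +i* y0 => z0A z0max'.
have z0max z : rho <= normc z <= r -> complex.Re (f z) + e * normc z ^+ 2 <=
    complex.Re (f z0) + e * normc z0 ^+ 2.
  case: z => x y zA; have := z0max' (x, y); rewrite inE => /(_ ((AE _ _).2 zA)).
  by rewrite !normc_sqr.
clearbody z0; clear z0max' x0 y0.
have z0big : B + e * r ^+ 2 < complex.Re (f z0) + e * normc z0 ^+ 2.
  apply: lt_le_trans (z0max z1 z1A); rewrite Real; apply: lt_le_trans er _.
  by rewrite lerDl mulr_ge0 ?sqr_ge0// ltW.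
have bd z : rho <= normc z <= r -> normc z = rho \/ normc z = r ->
    complex.Re (f z) + e * normc z ^+ 2 <= B + e * r ^+ 2.
  move=> /andP[z1r zr] zb; apply: lerD; last first.
    by rewrite ler_pM2l// ler_pXn2r// nnegrE ?normc_ge0// ltW.
  apply: le_trans (ler_norm _) _; apply: le_trans (Re_le_normc _) _.
  have [/eqP nz0 _] := nz _ z1r.
  rewrite Normc.normcM normal mul1r normh// ler_pdivrMr ?gbd//.
  by rewrite exprn_gt0//; exact: lt_le_trans z1r.
have /andP[z0l z0r] := z0A.
have z0l' : rho < normc z0.
  rewrite lt_neqAle z0l andbT; apply/eqP => E.
  by have := bd z0 z0A (or_introl (esym E)); rewrite leNgt z0big.
have z0r' : normc z0 < r.
  rewrite lt_neqAle z0r andbT; apply/eqP => E.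
  by have := bd z0 z0A (or_intror E); rewrite leNgt z0big.
pose d := Num.min (normc z0 - rho) (r - normc z0).
have d0 : 0 < d by rewrite lt_min !subr_gt0 z0l'.
have dA z : normc (z - z0) <= d -> rho <= normc z <= r.
  rewrite le_min => /andP[? ?].
  have := complex.le_normcD z0 (z - z0); have := complex.le_normcD z (z0 - z).
  rewrite ![_ + (_ - _)]addrC !subrK -(complex.normcN (z0 - z)) opprB => ? ?.
  by apply/andP; split; lra.
apply: (@complex_no_strict_max (fun z => f z + (2 * e%:C * z0^*) * z) z0 d e d0 e0).
- move=> z zd; exact: (@derivable_scale_addlin R[i] h al _ z (hd z (dA z zd))).
- move=> z zd; have := z0max z (dA z zd); rewrite (normc_sqrD z0 z) !raddfD/=.
  have -> : complex.Re (2 * z0^* * (z - z0)) =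
      complex.Re (2 * z0^* * z) - complex.Re (2 * z0^* * z0).
    by rewrite mulrBr raddfB.
  have E w : complex.Re (2 * e%:C * z0^* * w) = e * complex.Re (2 * z0^* * w).
    by case: w (z0) => a b [a' b'] /=; ring.
  rewrite !E; lra.
Qed.
End ComplexVariable.

(** * Norm, topology and automorphisms of the complex space *)

Section ComplexSpace.
Variables (R : realType) (k : nat).
Implicit Types (z w : Cn R k).
Local Notation normc := (@Normc.normc R).

Lemma euclidean_normE z : euclidean_norm z = Num.sqrt (\sum_(i < k) normc (z ord0 i) ^+ 2).
Proof. by []. Qed.

Lemma coord_le_euclidean_norm z i : normc (z ord0 i) <= euclidean_norm z.
Proof.
rewrite euclidean_normE -(ger0_norm (normc_ge0 _ (z ord0 i))) -sqrtr_sqr ler_wsqrtr//.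
rewrite (bigD1 i)//= lerDl; apply: sumr_ge0 => j _; exact: sqr_ge0.
Qed.

(** The factor [k], instead of its square root, is good enough because the radii
    of the construction are divided by [2 * k]. *)
Lemma euclidean_norm_le z (c : R) : 0 <= c ->
  (forall i, normc (z ord0 i) <= c) -> euclidean_norm z <= k%:R * c.
Proof.
move=> c0 zc; rewrite euclidean_normE.
rewrite -[leRHS]ger0_norm ?mulr_ge0// -sqrtr_sqr ler_wsqrtr//.
apply: (@le_trans _ _ (\sum_(i < k) c ^+ 2)).
  by apply: ler_sum => i _; rewrite ler_pXn2r ?nnegrE ?normc_ge0.
rewrite sumr_const card_ord exprMn -[_ *+ k]mulr_natl ler_wpM2r ?sqr_ge0//.
by rewrite -natrX ler_nat; case: (k) => // n; rewrite -mulnn leq_pmulr.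
Qed.

Lemma euclidean_norm0 : euclidean_norm (0 : Cn R k) = 0.
Proof.
rewrite euclidean_normE big1 ?sqrtr0// => i _.
by rewrite mxE Normc.normc0 expr0n.
Qed.

Lemma euclidean_norm_scale (t : R) z : 0 <= t ->
  euclidean_norm (t%:C *: z) = t * euclidean_norm z.
Proof.
move=> t0; rewrite !euclidean_normE -{2}(ger0_norm t0) -sqrtr_sqr -sqrtrM ?sqr_ge0//.
congr Num.sqrt; rewrite mulr_sumr; apply: eq_bigr => i _.
rewrite mxE Normc.normcM exprMn; congr (_ * _).
by rewrite normc_sqr /= expr0n addr0.
Qed.

Lemma nbhs_coordP z (V : set (Cn R k)) : nbhs z V <->
  exists2 a : R, 0 < a & forall w, (forall i, normc (w ord0 i - z ord0 i) < a) -> V w.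
Proof.
split.
  move=> /nbhs_ballP[e /= /gt0_complex[a a0 ->] zV]; exists a => // w wz; apply: zV.
  split=> [|i j]; first by rewrite ltcR.
  rewrite (ord1 i) /ball /= distrC normcRE ltcR; exact: wz.
move=> [a a0 aV]; apply/nbhs_ballP; exists a%:C => /=; first by rewrite ltcR.
move=> w [_ wz]; apply: aV => i; have := wz ord0 i.
by rewrite /ball /= distrC normcRE ltcR.
Qed.

(** The uniform structure on row vectors comes from the sup norm with values in
    R[i]; only the comparability of the norms matters. *)
Lemma uniform_cvg0P (V : set (Cn R k)) (F : nat -> Cn R k -> Cn R k) :
  {uniform V, F @ \oo --> (cst 0 : Cn R k -> Cn R k)} <->
  forall e : R, 0 < e -> exists N : nat, forall n z, (N <= n)%N -> V z ->
    euclidean_norm (F n z) < e.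
Proof.
split.
  move=> H e e0.
  pose c := e / (k%:R + 1).
  have k0 : 0 < k%:R + 1 :> R by rewrite ltr_wpDl.
  have c0 : 0 < c by rewrite divr_gt0.
  have : nbhs ((cst 0 : Cn R k -> Cn R k) : {uniform` V -> Cn R k})
      [set h | forall y, V y -> ball (0 : Cn R k) c%:C (h y)].
    apply/uniform_nbhs; exists [set p | ball p.1 c%:C p.2]; split; last by [].
    by rewrite -entourage_ballE; exists c%:C => /=; rewrite ?ltcR.
  move=> /H [N _ HN]; exists N => n z Nn Vz.
  have [_ hb] := HN n Nn z Vz.
  apply: (@le_lt_trans _ _ (k%:R * c)).
    apply: euclidean_norm_le; first exact: ltW.
    move=> i; have := hb ord0 i; rewrite /ball /= mxE sub0r normrN normcRE ltcR.
    exact: ltW.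
  have -> : e = (k%:R + 1) * c by rewrite /c; field; rewrite gt_eqF.
  by rewrite ltr_pM2r// ltrDl.
move=> H P /uniform_nbhs[E [entE EP]].
have := entE; rewrite -entourage_ballE => -[e /= /gt0_complex[c c0 ->] cE].
have [N HN] := H c c0; exists N => // n /= Nn; apply: EP => y Vy; apply: cE.
split=> [|i j]; first by rewrite ltcR.
rewrite /= (ord1 i) /ball /= mxE sub0r normrN normcRE ltcR.
exact: le_lt_trans (coord_le_euclidean_norm _ _) (HN _ _ _ Vy).
Qed.

Lemma normc_continuous : continuous (normc : R[i] -> R).
Proof.
move=> z; apply/(@cvgrPdist_le _ _ _ (nbhs z)) => e e0.
apply/nbhs_ballP; exists e%:C => /=; first by rewrite ltcR.
move=> w; rewrite /ball /= normcRE ltcR => wz.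
have := complex.le_normcD w (z - w); have := complex.le_normcD z (w - z).
have E : normc (w - z) = normc (z - w) by rewrite -opprB; exact: complex.normcN.
rewrite ![_ + (_ - _)]addrC !subrK E ler_norml => ? ?; apply/andP; split; lra.
Qed.

Lemma euclidean_norm_continuous : continuous (@euclidean_norm R k).
Proof.
move=> z; apply: (@continuous_cvg _ _ _ _ _
  (fun z => \sum_(i < k) normc (z ord0 i) ^+ 2) Num.sqrt).
  exact: nbhs_filter.
  exact: sqrt_continuous.
apply: (@cvg_big _ _ +%R 0).
  exact: add_continuous.
  exact: nbhs_filter.
move=> i _.
have cc : {for z, continuous (fun w : Cn R k => w ord0 i)} :=
  @coord_continuous R[i] 1 k ord0 i z.
have h : {for z, continuous (fun w : Cn R k => normc (w ord0 i))} :=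
  continuous_comp cc (@normc_continuous (z ord0 i)).
exact: (cvgM h h).
Qed.

Lemma euclidean_ball_open (r : R) : open (euclidean_ball r : set (Cn R k)).
Proof.
have -> : euclidean_ball r = @euclidean_norm R k @^-1` [set x | x < r] by [].
by apply: open_comp; [move=> z _; exact: euclidean_norm_continuous|exact: open_lt].
Qed.

Lemma holomorphic_continuous (f : Cn R k -> Cn R k) : holomorphic f -> continuous f.
Proof. by move=> hf z; exact: differentiable_continuous (hf z). Qed.

Lemma holomorphic_automorphism_id : holomorphic_automorphism (id : Cn R k -> Cn R k).
Proof.
have h : holomorphic (id : Cn R k -> Cn R k) by move=> z; apply: ex_diff.
by split=> //; exists id; split.
Qed.

Lemma holomorphic_automorphism_comp (f g : Cn R k -> Cn R k) :
  holomorphic_automorphism f -> holomorphic_automorphism g ->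
  holomorphic_automorphism (f \o g).
Proof.
have hc (f' g' : Cn R k -> Cn R k) :
    holomorphic f' -> holomorphic g' -> holomorphic (f' \o g').
  by move=> hf hg z; exact: differentiable_comp (hg z) (hf (g' z)).
move=> [hf [f' [hf' fK f'K]]] [hg [g' [hg' gK g'K]]]; split; first exact: hc.
exists (g' \o f'); split; first exact: hc.
  exact: can_comp.
exact: can_comp.
Qed.

Lemma holomorphic_automorphism_iter (f : Cn R k -> Cn R k) n :
  holomorphic_automorphism f -> holomorphic_automorphism (iter n f).
Proof.
move=> hf; elim: n => [|n IH]; first exact: holomorphic_automorphism_id.
exact: (holomorphic_automorphism_comp _ _ hf IH).
Qed.

Lemma holomorphic_automorphism_comp_upto (F : nat -> Cn R k -> Cn R k) j :
  (forall i, holomorphic_automorphism (F i)) -> holomorphic_automorphism (comp_upto F j).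
Proof.
move=> hF; elim: j => [|j IH]; first exact: holomorphic_automorphism_id.
exact: (holomorphic_automorphism_comp _ _ (hF j) IH).
Qed.

(** Applied to the inverse of a composition of the maps, this gives connected sets
    that join 0 to the points of the preimage of a ball. *)
Lemma ray_connected (h : Cn R k -> Cn R k) w : continuous h ->
  connected ((fun t : R => h (t%:C *: w)) @` `[0, 1]).
Proof.
move=> ch; apply: connected_continuous_connected; first exact: segment_connected.
apply: continuous_subspaceT => t.
apply: (@continuous_cvg _ _ _ _ _ (fun t : R => t%:C *: w) h); first exact: ch.
apply: (@cvgZr_tmp _ _ _ _ _ (fun t : R => t%:C)).
apply/cvgrPdist_lt => e /gt0_complex[c c0 ->]; apply/nbhs_ballP; exists c => //= s.
by rewrite /ball /= -rmorphB normcRE /= expr0n addr0 sqrtr_sqr ltcR.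
Qed.

Lemma line_derivable (h : Cn R k -> Cn R k) w v i (x : R[i]) : holomorphic h ->
  derivable (fun s : R[i] => h (w + s *: v) ord0 i) x 1.
Proof.
move=> hh; apply/derivable1_diffP.
have d1 : differentiable (fun s : R[i] => w + s *: v) x.
  apply: differentiableD; first exact: differentiable_cst.
  exact: differentiableZl.
have d2 := differentiable_comp d1 (hh _).
exact: (differentiable_comp d2 (differentiable_coord _ ord0 i)).
Qed.

End ComplexSpace.

(** * Basins and Fatou domains *)

Section CalibratedBasin.
Variables (R : realType) (k : nat).
Local Notation normc := (@Normc.normc R).

(** The three circles estimate for each coordinate along the complex line through
    w and w + v. *)
Lemma hadamard_line (h : Cn R k -> Cn R k) (w v : Cn R k) (rho B : R) (N : nat) :
  holomorphic h -> 0 < rho -> rho <= 1 -> 0 <= B ->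
  (forall x : R[i], normc x = rho \/ normc x = 2 ->
     euclidean_norm (h (w + x *: v)) <= B * normc x ^+ N) ->
  euclidean_norm (h (w + v)) <= k%:R * B.
Proof.
move=> hh rho0 rho1 B0 hbd; apply: euclidean_norm_le => // i.
have rho2 : rho <= 2 by lra.
have := @hadamard_annulus R (fun x => h (w + x *: v) ord0 i) N rho 2 B rho0 rho2.
move=> /(_ _ _ 1); rewrite scale1r Normc.normc1 expr1n mulr1; apply.
- by move=> z _; exact: line_derivable.
- by move=> z zb; apply: le_trans (coord_le_euclidean_norm _ _ _ _) (hbd z zb).
- by rewrite rho1 ler1n.
Qed.

(** Here [G j] is the iterated map F_j.  The sequence [B] is the bound to be
    reached for the coordinates: a vector whose coordinates are at most [B j] lies
    in the ball of radius [r j].  The exponent [N j] is large enough for [BN],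
    which handles the circle of radius 2, and the contraction [step] is strong
    enough to gain a factor [j.+1] raised to the power [N j] at time [j], where
    [j.+1] eventually exceeds any constant. *)
Section Basin.
Variables (G : nat -> Cn R k -> Cn R k) (r B : nat -> R) (N : nat -> nat).
Hypothesis k1 : (1 <= k)%N.
Hypothesis autG : forall j, holomorphic_automorphism (G j).
Hypothesis G0 : forall j, G j 0 = 0.
Hypothesis r0 : forall j, 0 < r j.
Hypothesis B0 : forall j, 0 < B j.
Hypothesis kB : forall j, k%:R * B j < r j.
Hypothesis BN : forall j, 1 <= B j * 2 ^+ N j.
Hypothesis step : forall j z, euclidean_ball (r j) z ->
  euclidean_norm (G j z) * j.+2%:R ^+ N j.+1 <= B j.+1.

Let Om := \bigcup_j (comp_upto G j @^-1` euclidean_ball (r j)).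

Let Br j : B j < r j.
Proof.
apply: le_lt_trans (kB j); rewrite -[leLHS]mul1r ler_wpM2r ?ler1n//; exact: ltW.
Qed.

Lemma invariant_ball j z : euclidean_ball (r j) z -> euclidean_ball (r j.+1) (G j z).
Proof.
move=> zr; apply: le_lt_trans (Br j.+1); apply: le_trans (step _ _ zr).
by rewrite ler_peMr ?sqrtr_ge0// exprn_ege1// ler1n.
Qed.

Lemma orbit_in_balls l j z : (l <= j)%N ->
  euclidean_ball (r l) (comp_upto G l z) -> euclidean_ball (r j) (comp_upto G j z).
Proof.
move=> /subnK <- zr; elim: (j - l)%N => //= n; exact: invariant_ball.
Qed.

Lemma orbit_super_small l j z : (l < j)%N ->
  euclidean_ball (r l) (comp_upto G l z) ->
  euclidean_norm (comp_upto G j z) * j.+1%:R ^+ N j <= B j.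
Proof.
case: j => // j lj zr; apply: step; exact: orbit_in_balls zr.
Qed.

Let autC j : holomorphic_automorphism (comp_upto G j).
Proof. exact: holomorphic_automorphism_comp_upto. Qed.

Let cC j : continuous (comp_upto G j).
Proof. by apply: holomorphic_continuous; exact: (autC j).1. Qed.

Let oOmj j : open (comp_upto G j @^-1` euclidean_ball (r j)).
Proof.
by apply: open_comp; [move=> z _; exact: cC|exact: euclidean_ball_open].
Qed.

Let C0 j : comp_upto G j 0 = 0.
Proof. by elim: j => //= j ->. Qed.

Let Om0 : Om 0.
Proof. by exists 0%N => //=; rewrite /euclidean_ball /= euclidean_norm0. Qed.

(** Connectedness: the basin is the union, over all j and all w in the ball of
    radius r j, of the images of the segments from 0 to w by the inverse of the
    j-th composition; all these images contain 0. *)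
Lemma basin_fatou_domain : r @ \oo --> (0 : R) -> fatou_domain G Om.
Proof.
move=> rlim; split=> //.
- by apply: bigcup_open => j _; exact: oOmj.
- have [H HP] := choice (fun j => (autC j).2).
  pose I := [set p : nat * Cn R k | euclidean_ball (r p.1) p.2].
  pose S (p : nat * Cn R k) := (fun t : R => H p.1 (t%:C *: p.2)) @` `[0, 1].
  have -> : Om = \bigcup_(p in I) S p.
    apply/seteqP; split=> [z [j _ zj]|z [[j w] wr [t /=]]].
      exists (j, comp_upto G j z) => //; exists 1; first by rewrite /= in_itv /= ler01 lexx.
      by have [_ K _] := HP j; rewrite scale1r K.
    rewrite in_itv /= => /andP[t0 t1] <-; exists j => //=.
    have [_ _ K] := HP j; rewrite K /euclidean_ball /= euclidean_norm_scale//.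
    by apply: le_lt_trans wr; rewrite ler_piMl// sqrtr_ge0.
  apply: bigcup_connected.
    exists 0 => -[j w] _; exists 0; first by rewrite /= in_itv /= ler01 lexx.
    by have [_ K _] := HP j; rewrite scale0r -(C0 j) K.
  move=> [j w] _; apply: ray_connected.
  by have [hH _ _] := HP j; exact: holomorphic_continuous.
- move=> z [l _ zl]; exists (comp_upto G l @^-1` euclidean_ball (r l)).
    exact: open_nbhs_nbhs.
  apply/uniform_cvg0P => e e0.
  move/cvgrPdist_lt : rlim => /(_ e e0)[M _ HM].
  exists (maxn M l) => n w; rewrite geq_max => /andP[Mn ln] wl.
  have lt := orbit_in_balls l n.+1 w (leqW ln) wl.
  apply: (lt_trans lt); have := HM n.+1 (leqW Mn).
  by rewrite /= sub0r normrN; apply: le_lt_trans; exact: ler_norm.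
Qed.

(** U is connected and meets the open set [Om] at 0, so it is enough that [Om] be
    closed in U.  This is where the three circles estimate is used. *)
Lemma fatou_domain_sub_basin U : fatou_domain G U -> U `<=` Om.
Proof.
move=> [oU cU U0 cvgU].
have oOm : open Om by apply: bigcup_open => j _; exact: oOmj.
suff closed_in_U z : U z -> closure Om z -> Om z.
  have -> : U = U `&` Om; last by move=> z [].
  symmetry; apply: cU.
  - by exists 0.
  - by exists Om.
  - exists (closure Om); first exact: closed_closure.
    apply/seteqP; split=> z [Uz Oz]; split=> //; first exact: subset_closure.
    exact: closed_in_U.
move=> Uz clz; have [V /nbhs_coordP[a a0 aV] /uniform_cvg0P ucvg] := cvgU z Uz.
have a30 : 0 < a / 3 by lra.
have [w [[l _ wl] wz]] : Om `&` [set w | forall i, normc (w ord0 i - z ord0 i) < a / 3] !=set0.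
  by apply: clz; apply/nbhs_coordP; exists (a / 3).
have [b b0 bl] := (nbhs_coordP _ _ _ _).1 (open_nbhs_nbhs (conj (oOmj l) wl)).
pose v := z - w.
have va i : normc (v ord0 i) < a / 3.
  rewrite /v !mxE -opprB; apply: le_lt_trans (wz i).
  by rewrite complex.normcN.
(* For [normc x <= 2], the point [w + x *: v] is in V, since its distance to z is
   less than [3 * (a / 3)] in each coordinate; for [normc x <= rho] it stays in a
   neighbourhood of w contained in the basin. *)
pose rho := Num.min 1 (b / a).
have rho0 : 0 < rho by rewrite lt_min ltr01 divr_gt0.
have rho1 : rho <= 1 by rewrite ge_min lexx.
have rhoba : rho * a <= b by rewrite -ler_pdivlMr// ge_min lexx orbT.
have [J HJ] := ucvg 1 ltr01.
have [j [lj Jj jrho]] : exists j, [/\ (l < j)%N, (J < j)%N & j.+1%:R^-1 <= rho].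
  pose n := Num.truncn rho^-1.
  exists (maxn (maxn l J).+1 n.+1); split.
  - by rewrite leq_max ltnS leq_maxl.
  - by rewrite leq_max ltnS leq_maxr.
  rewrite -[leRHS]invrK lef_pV2 ?posrE ?invr_gt0//.
  apply: ltW; apply: lt_le_trans (truncnS_gt _) _.
  by rewrite ler_nat -/n ltnW// ltnS leq_maxr.
exists j => //=; rewrite /euclidean_ball /=.
apply: le_lt_trans (kB j).
have -> : z = w + v by rewrite /v addrC subrK.
apply: (hadamard_line _ w v rho (B j) (N j) (autC j).1 rho0 rho1 (ltW (B0 j))).
move=> x [xr|x2].
  have xl : euclidean_ball (r l) (comp_upto G l (w + x *: v)).
    apply: bl => i; have -> : (w + x *: v) ord0 i - w ord0 i = x * v ord0 i.
      by rewrite /v !mxE; ring.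
    rewrite Normc.normcM xr; apply: lt_le_trans rhoba; rewrite ltr_pM2l//.
    by have := va i; lra.
  have := orbit_super_small _ _ _ lj xl.
  have p0 : 0 < j.+1%:R ^+ N j :> R by rewrite exprn_gt0.
  rewrite -ler_pdivlMr// => /le_trans; apply.
  rewrite xr ler_pM2l// -exprVn.
  by apply: lerXn2r => //; rewrite nnegrE ?invr_ge0// ltW.
have Vx : V (w + x *: v).
  apply: aV => i; have -> : (w + x *: v) ord0 i - z ord0 i = (x - 1) * v ord0 i.
    by rewrite /v !mxE; ring.
  rewrite Normc.normcM.
  have : normc (x - 1) <= 3.
    apply: le_trans (complex.le_normcD _ _) _.
    by rewrite complex.normcN Normc.normc1 x2; lra.
  have := va i; have := normc_ge0 _ (v ord0 i); have := normc_ge0 _ (x - 1); nra.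
rewrite x2; apply: le_trans (BN j); apply: ltW.
by case: j lj Jj {jrho} => // j _ Jj; exact: HJ.
Qed.

End Basin.

Lemma iterated_contraction_small (f : Cn R k -> Cn R k) (rad c : R) : 0 < rad -> 0 < c ->
  (exists mu C : R, [/\ 0 < mu < 1, 0 < C & forall (z : Cn R k) n,
     euclidean_ball rad z -> euclidean_norm (iter n f z) <= C * mu ^+ n * euclidean_norm z]) ->
  exists m, forall n z, (m <= n)%N -> euclidean_ball rad z ->
    euclidean_norm (iter n f z) <= c.
Proof.
move=> rad0 c0 [mu [C [/andP[mu0 mu1] C0 H]]].
have mu01 : 0 <= mu < 1 by rewrite ltW.
have [m hm] := exists_geometric_lt R mu (C * rad) c mu01 c0.
exists m => n z mn zr; apply: le_trans (H z n zr) _.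
have h1 : C * mu ^+ n * euclidean_norm z <= C * mu ^+ n * rad.
  by apply: ler_wpM2l; [rewrite mulr_ge0 ?exprn_ge0 // ltW|exact: ltW].
apply: le_trans h1 _; rewrite mulrAC; apply: le_trans (ltW hm).
by rewrite ler_pM2l ?mulr_gt0// ler_wiXn2l// ltW.
Qed.

End CalibratedBasin.

Theorem theorem8 (R : realType) (k : nat) (hk : (1 <= k)%N)
    (f : nat -> Cn R k -> Cn R k)
    (hf : forall j, holomorphic_automorphism (f j))
    (hf0 : forall j, attracting_at0 (f j))
    (r : nat -> R)
    (hr : forall j, 0 < r j)
    (hr0 : r @ \oo --> (0 : R))
    (hcontr : forall j, exists mu C : R, [/\ 0 < mu < 1, 0 < C &
       forall (z : Cn R k) (n : nat), euclidean_ball (r j) z ->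
         euclidean_norm (iter n (f j) z) <= C * mu ^+ n * euclidean_norm z]) :
  exists m : nat -> nat, forall n : nat -> nat, (forall j, (m j <= n j)%N) ->
    (forall j, iter (n j) (f j) @` euclidean_ball (r j) `<=` euclidean_ball (r j.+1)) /\
    fatou_component0 (iterates f n) = calibrated_basin f r n.
Proof.
have k0 : 0 < k%:R :> R by rewrite ltr0n.
pose B j := r j / (2 * k%:R).
have B0 j : 0 < B j by rewrite divr_gt0// mulr_gt0.
have kB j : k%:R * B j < r j.
  have -> : k%:R * B j = r j / 2 by rewrite /B; field; rewrite gt_eqF.
  by have := hr j; lra.
have /choice[N BN] j : exists N, 1 <= B j * 2 ^+ N.
  have [N /ltW hN] := exists_geometric_lt R 2^-1 1 (B j) (ltac:(lra)) (B0 j).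
  exists N; rewrite mul1r exprVn in hN.
  by rewrite -ler_pdivrMr ?exprn_gt0// mul1r.
have /choice[m hm] j : exists m, forall n z, (m <= n)%N -> euclidean_ball (r j) z ->
    euclidean_norm (iter n (f j) z) <= B j.+1 / j.+2%:R ^+ N j.+1.
  apply: (iterated_contraction_small _ _ _ _ _ (hr j) _ (hcontr j)).
  by rewrite divr_gt0// exprn_gt0.
exists m => n mn.
have autG j : holomorphic_automorphism (iterates f n j).
  exact: holomorphic_automorphism_iter.
have G0 j : iterates f n j 0 = 0.
  by rewrite /iterates; elim: (n j) => //= i ->; exact: (hf0 j).1.
have step j z : euclidean_ball (r j) z ->
    euclidean_norm (iterates f n j z) * j.+2%:R ^+ N j.+1 <= B j.+1.
  by move=> zr; rewrite -ler_pdivlMr ?exprn_gt0//; exact: hm.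
split.
  move=> j _ [z zr <-].
  exact: (invariant_ball R k (iterates f n) r B N hk B0 kB step j z zr).
apply/seteqP; split=> [z [U fU Uz]|z zO].
  exact: (fatou_domain_sub_basin R k _ r B N hk autG hr B0 kB BN step U fU z Uz).
exists (calibrated_basin f r n) => //.
exact: (basin_fatou_domain R k _ r B N hk autG G0 hr B0 kB step hr0).
Qed.
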